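(* Let $C$ be an extremal doubly even self-dual binary code of length $8t$ with covering radius $R$. Then there is a vector $x\in\mathbb{F}_2^{8t}$ of weight $2\lfloor \frac{R+1}{2}\rfloor-1$ such that the code $$C(x)= (0,0,C^0) \cup (1,1,C^2) \cup (1,0,C^1) \cup (0,1,C^3)$$ is a singly even self-dual $$\left[8t+2,\;4t+1,\;\min\left\{4\left\lfloor \tfrac{t}{3} \right\rfloor + 4,\; 2\left\lfloor \tfrac{R+1}{2}\right\rfloor\right\}\right]$$ code with minimal shadow.
   Context: All codes are binary: a code of length $n$ is a subspace of $\mathbb{F}_2^n$, and $[n,k,d]$ denotes length $n$, dimension $k$, minimum weight $d$. A code $C$ is self-dual if $C=C^\perp$ with respect to the standard inner product. A self-dual code is doubly even if all codeword weights are $\equiv 0 \pmod 4$, and singly even if it contains a codeword of weight $\equiv 2 \pmod 4$. A self-dual code of length $n$ has minimum weight at most $4\lfloor n/24\rfloor+4$ unless $n\equiv 22 \pmod{24}$, when the bound is $4\lfloor n/24\rfloor+6$; it is extremal if it meets this bound. The covering radius of $C$ is the maximum over all cosets of $C$ in $\mathbb{F}_2^{n}$ of the minimum weight of the coset. Construction of $C(x)$: let $C$ be a doubly even self-dual code of length $8t$ and $x\in\mathbb{F}_2^{8t}$ a vector of odd weight. Let $C^0$ be the subcode of $C$ consisting of all codewords orthogonal to $x$. There are cosets $C^1,C^2,C^3$ of $C^0$ such that $(C^0)^\perp = C^0\cup C^1\cup C^2\cup C^3$, where $C=C^0\cup C^2$ and $x+C=C^1\cup C^3$. Here $(a,b,C^i)=\{(a,b,c)\mid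 c\in C^i\}\subseteq \mathbb{F}_2^{8t+2}$. For a singly even self-dual code $D$, let $D_0$ be the subcode of codewords of weight $\equiv 0\pmod 4$; the shadow of $D$ is $D_0^\perp\setminus D$. A singly even self-dual code of length $n$ is said to have minimal shadow if the minimum weight of its shadow is $4,1,2,3$ when $n\equiv 0,2,4,6 \pmod 8$, respectively (so for length $8t+2$ the shadow has minimum weight $1$). *)

(* Defs.v *)
From HB Require Import structures.
From mathcomp Require Import all_boot all_order all_algebra.
Set Implicit Arguments.
Unset Strict Implicit.
Unset Printing Implicit Defensive.
Import GRing.Theory.
Local Open Scope ring_scope.

(* Codes are subspaces C : {vspace 'rV['F_2]_n}; notions that also concern
   non-linear sets of vectors (cosets, shadows, unions of cosets) are stated on
   {set 'rV['F_2]_n}. *)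
Definition codewords n (C : {vspace 'rV['F_2]_n}) : {set 'rV['F_2]_n} :=
  [set v in C].

Definition wt n (v : 'rV['F_2]_n) : nat := #|[set i | v 0 i != 0]|.

Definition dot n (u v : 'rV['F_2]_n) : 'F_2 := \sum_i u 0 i * v 0 i.

(* The neutral value n only matters when A is empty, since wt v <= n. *)
Definition min_wt n (A : {set 'rV['F_2]_n}) : nat :=
  \big[minn/n]_(v in A) wt v.

Definition min_weight n (C : {vspace 'rV['F_2]_n}) : nat :=
  min_wt (codewords C :\ 0).

Definition translate n (u : 'rV['F_2]_n) (A : {set 'rV['F_2]_n}) :
  {set 'rV['F_2]_n} := [set u + v | v in A].

Definition covering_radius n (C : {vspace 'rV['F_2]_n}) : nat :=
  \max_(u : 'rV['F_2]_n) min_wt (translate u (codewords C)).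

Definition dual n (A : {set 'rV['F_2]_n}) : {set 'rV['F_2]_n} :=
  [set u | [forall v in A, dot u v == 0]].

Definition self_dual n (C : {vspace 'rV['F_2]_n}) : Prop :=
  codewords C = dual (codewords C).

Definition doubly_even n (C : {vspace 'rV['F_2]_n}) : Prop :=
  forall v, v \in C -> (wt v = 0 %[mod 4])%N.

Definition singly_even n (C : {vspace 'rV['F_2]_n}) : Prop :=
  exists2 v, v \in C & (wt v = 2 %[mod 4])%N.

Definition self_dual_bound (n : nat) : nat :=
  if (n %% 24 == 22)%N then (4 * (n %/ 24) + 6)%N else (4 * (n %/ 24) + 4)%N.

(* Used for self-dual codes only. *)
Definition extremal n (C : {vspace 'rV['F_2]_n}) : Prop :=
  min_weight C = self_dual_bound n.

Definition shadow n (D : {vspace 'rV['F_2]_n}) : {set 'rV['F_2]_n} :=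
  dual [set v in D | (wt v %% 4 == 0)%N] :\: codewords D.

(* The length n of a self-dual code is even, so the last branch is n = 6 mod 8. *)
Definition minimal_shadow_weight (n : nat) : nat :=
  match (n %% 8)%N with 0 => 4 | 2 => 1 | 4 => 2 | _ => 3 end.

Definition minimal_shadow n (D : {vspace 'rV['F_2]_n}) : Prop :=
  min_wt (shadow D) = minimal_shadow_weight n.

Definition orth_subcode n (C : {vspace 'rV['F_2]_n}) (x : 'rV['F_2]_n) :
  {set 'rV['F_2]_n} := [set c in C | dot c x == 0].

Definition is_coset n (A B : {set 'rV['F_2]_n}) : Prop :=
  exists u, B = translate u A.

(* These conditions determine C2, and determine C1 and C3 up to exchanging
   them; both labellings are allowed. *)
Definition coset_labelling n (C : {vspace 'rV['F_2]_n}) (x : 'rV['F_2]_n)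
    (C1 C2 C3 : {set 'rV['F_2]_n}) : Prop :=
  let C0 := orth_subcode C x in
  [/\ [/\ is_coset C0 C1, is_coset C0 C2 & is_coset C0 C3],
      dual C0 = C0 :|: C1 :|: C2 :|: C3,
      codewords C = C0 :|: C2
    & translate x (codewords C) = C1 :|: C3].

Definition prefix2 n (a b : 'F_2) (A : {set 'rV['F_2]_n}) :
  {set 'rV['F_2]_(2 + n)} :=
  [set row_mx (\row_(i < 2) [:: a; b]`_i) c | c in A].

Definition glued n (C0 C1 C2 C3 : {set 'rV['F_2]_n}) :
  {set 'rV['F_2]_(2 + n)} :=
  prefix2 0 0 C0 :|: prefix2 1 1 C2 :|: prefix2 1 0 C1 :|: prefix2 0 1 C3.

Lemma F2_cases (a : 'F_2) : a = 0 \/ a = 1.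
Proof.
case: a => [[|[|m]] lt_m] //; first by left; apply: val_inj.
by right; apply: val_inj.
Qed.

Lemma F2_add1 : 1 + 1 = 0 :> 'F_2.
Proof. exact: val_inj. Qed.

Lemma F2_addbb n (u : 'rV['F_2]_n) : u + u = 0.
Proof.
by apply/rowP => i; rewrite !mxE; case: (F2_cases (u 0 i)) => ->;
  rewrite ?addr0 ?F2_add1.
Qed.

Lemma dotC n (u v : 'rV['F_2]_n) : dot u v = dot v u.
Proof. by apply: eq_bigr => i _; rewrite mulrC. Qed.

Lemma dotDl n (u v w : 'rV['F_2]_n) : dot (u + v) w = dot u w + dot v w.
Proof. by rewrite /dot -big_split; apply: eq_bigr => i _; rewrite mxE mulrDl. Qed.

Lemma dot1 n (u : 'rV['F_2]_n) : dot (const_mx 1) u = (wt u)%:R.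
Proof.
rewrite /dot /wt -sum1_card natr_sum big_mkcond [RHS]big_mkcond.
apply: eq_bigr => i _; rewrite !mxE mul1r inE /=.
by case: (F2_cases (u 0 i)) => ->.
Qed.

(* The cosets C1, C2, C3 exist, so that quantifying over them is not vacuous. *)
Lemma coset_labelling_exists n (C : {vspace 'rV['F_2]_n}) (x : 'rV['F_2]_n) :
  self_dual C -> doubly_even C -> odd (wt x) ->
  exists C1 C2 C3, coset_labelling C x C1 C2 C3.
Proof.
move=> sdC deC oddx; pose j : 'rV['F_2]_n := const_mx 1.
have natF2 m : (m%:R : 'F_2) = (odd m)%:R.
  by apply: val_inj; rewrite /= !val_Fp_nat // modn2; case: (odd m).
have dualP (A : {set 'rV['F_2]_n}) u :
    reflect (forall v, v \in A -> dot u v = 0) (u \in dual A).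
  rewrite inE; apply: (iffP forall_inP) => H v /H; first by move/eqP.
  by move=> ->.
have jx : dot j x = 1 by rewrite dot1 natF2 oddx.
have inC u : (u \in C) = (u \in dual (codewords C)) by rewrite -sdC inE.
have Cdot u v : u \in C -> v \in C -> dot u v = 0.
  by rewrite inC => /dualP H vC; apply: H; rewrite inE.
have jC : j \in C.
  rewrite inC; apply/dualP => v; rewrite inE => /deC; rewrite mod0n => w4.
  by rewrite dot1 natF2 (divn_eq (wt v) 4) w4 addn0 oddM andbF.
pose C0 := orth_subcode C x.
have C0P c : (c \in C0) = (c \in C) && (dot c x == 0) by rewrite inE.
have trP u (A : {set 'rV['F_2]_n}) v : (v \in translate u A) = (u + v \in A).
  apply/imsetP/idP => [[w wA ->] | uvA].
    by rewrite addrA F2_addbb add0r.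
  by exists (u + v); rewrite // addrA F2_addbb add0r.
have jCE c : (j + c \in C) = (c \in C) by rewrite rpredDl.
have C02 : codewords C = C0 :|: translate j C0.
  apply/setP => c; rewrite in_setU trP !C0P jCE inE dotDl jx.
  by case: (c \in C) => //=; case: (F2_cases (dot c x)) => ->.
exists (translate x C0), (translate j C0), (translate (x + j) C0).
have C13 : translate x (codewords C) = translate x C0 :|: translate (x + j) C0.
  apply/setP => c; rewrite trP C02 !in_setU !trP.
  by rewrite (addrC x j) -addrA.
split=> //; first by split; [exists x | exists j | exists (x + j)].
apply/setP => u.
have -> : (u \in C0 :|: translate x C0 :|: translate j C0
               :|: translate (x + j) C0) = (u \in C) || (x + u \in C).
  have <- : (u \in codewords C) = (u \in C) by rewrite inE.
  have <- : (u \in translate x (codewords C)) = (x + u \in C).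
    by rewrite trP inE.
  rewrite C13 C02 !in_setU.
  by rewrite -!orbA; congr orb; rewrite orbCA.
apply/dualP/orP => [uC0 | uC v].
  have uE c : c \in C -> dot u c = dot c x * dot u j.
    move=> cC; case: (F2_cases (dot c x)) => cx; rewrite cx.
      by rewrite mul0r uC0 // C0P cC cx eqxx.
    have : dot u (j + c) = 0 by rewrite uC0 // C0P jCE cC dotDl jx cx.
    rewrite dotC dotDl !(dotC _ u) mul1r.
    by case: (F2_cases (dot u j)) => ->; case: (F2_cases (dot u c)) => ->.
  case: (F2_cases (dot u j)) => uj; [left | right]; rewrite inC;
    apply/dualP => c; rewrite inE => cC.
    by rewrite uE // uj mulr0.
  rewrite dotDl uE // uj mulr1 dotC.
  by case: (F2_cases (dot c x)) => ->; rewrite ?addr0 ?F2_add1.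
rewrite C0P => /andP[vC /eqP vx]; case: uC => uC; first exact: Cdot.
by have := Cdot _ _ uC vC; rewrite dotDl dotC vx add0r.
Qed.

(* Main.v *)
(* The weights of an extremal doubly even self-dual code of length n = 8t lie in
   {d, d + 4, ..., n - d, n} with d = 4(t/3) + 4, so Delsarte's bound (the
   covering radius is at most the number of nonzero weights of the dual) gives
   R <= d.  Hence a minimum weight vector x of odd weight 2((R+1)/2) - 1 in its
   coset has weight less than d, and (1,0,x) or (0,1,x) is a minimum weight word
   of C(x): no word of weight d orthogonal to x has to be exhibited.

   Delsarte's bound for a self-dual C: if every vector of u + C has weight more
   than |W|, the sum over c in C of (-1)^(u.c) \prod_(w in W) (wt c - w)
   vanishes, by induction on W, since 2 wt c = n - \sum_i (-1)^(c_i) and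
   multiplying by (-1)^(c_i) replaces u by u + e_i.  But if W contains all nonzero
   weights of C and not 0, only the term c = 0 of the sum is nonzero. *)
Require Import Defs.
From mathcomp Require Import all_boot all_order all_algebra.
From mathcomp Require Import zify ring.
Set Implicit Arguments.
Unset Strict Implicit.
Unset Printing Implicit Defensive.
Import Order.TTheory GRing.Theory Num.Theory.
Local Open Scope ring_scope.

(** * Weights and inner products over ['F_2] *)

Lemma wt_sum n (v : 'rV['F_2]_n) : wt v = (\sum_i (v 0%R i != 0%R))%N.
Proof.
rewrite /wt -sum1_card big_mkcond; apply: eq_bigr => i _.
by rewrite inE; case: (v 0 i != 0).
Qed.

Lemma wt0 n : wt (0 : 'rV['F_2]_n) = 0%N.
Proof. by rewrite wt_sum big1 // => i _; rewrite mxE eqxx. Qed.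

Lemma wt_le n (v : 'rV['F_2]_n) : (wt v <= n)%N.
Proof. by have := max_card (mem [set i | v 0 i != 0]); rewrite card_ord. Qed.

Lemma wt_eq0 n (v : 'rV['F_2]_n) : wt v = 0%N -> v = 0.
Proof.
move/eqP; rewrite wt_sum sum_nat_eq0 => /forallP v0.
by apply/rowP => i; have := v0 i; rewrite mxE; case: (F2_cases (v 0 i)) => ->.
Qed.

(** Inclusion-exclusion on supports, in additive form to avoid truncated subtraction. *)
Lemma wtD_sum n (u v : 'rV['F_2]_n) :
  (wt (u + v) + 2 * \sum_i ((u 0%R i != 0%R) && (v 0%R i != 0%R)) =
   wt u + wt v)%N.
Proof.
rewrite !wt_sum big_distrr -!big_split; apply: eq_bigr => i _ /=; rewrite mxE.
by case: (F2_cases (u 0 i)) => ->; case: (F2_cases (v 0 i)) => ->;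
  rewrite ?addr0 ?add0r ?F2_add1.
Qed.

Lemma wtD_le n (u v : 'rV['F_2]_n) : (wt (u + v) <= wt u + wt v)%N.
Proof. by rewrite -wtD_sum leq_addr. Qed.

Lemma wt_delta n (i : 'I_n) : wt (delta_mx 0 i : 'rV['F_2]_n) = 1%N.
Proof.
rewrite wt_sum (bigD1 i) //= mxE !eqxx big1 // => j ne_ji.
by rewrite mxE eqxx (negPf ne_ji).
Qed.

Lemma natr_F2 m : (m%:R : 'F_2) = (odd m)%:R.
Proof. by apply: val_inj; rewrite /= !val_Fp_nat // modn2; case: (odd m). Qed.

Lemma natr_F2_eq0 m : ((m%:R : 'F_2) == 0) = ~~ odd m.
Proof. by rewrite natr_F2; case: (odd m). Qed.

Lemma dot_sum n (u v : 'rV['F_2]_n) :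
  dot u v = (\sum_i ((u 0%R i != 0%R) && (v 0%R i != 0%R)))%N%:R.
Proof.
rewrite natr_sum; apply: eq_bigr => i _.
by case: (F2_cases (u 0 i)) => ->; case: (F2_cases (v 0 i)) => ->;
  rewrite ?mulr0 ?mul0r ?mul1r.
Qed.

Lemma dot_self n (u : 'rV['F_2]_n) : dot u u = (wt u)%:R.
Proof.
by rewrite dot_sum wt_sum; congr (_%:R); apply: eq_bigr => i _; rewrite andbb.
Qed.

Lemma dot0 n (u : 'rV['F_2]_n) : dot u 0 = 0.
Proof. by rewrite /dot big1 // => i _; rewrite mxE mulr0. Qed.

Lemma dotDr n (u v w : 'rV['F_2]_n) : dot u (v + w) = dot u v + dot u w.
Proof. by rewrite dotC dotDl !(dotC _ u). Qed.

Lemma dotZl n a (u v : 'rV['F_2]_n) : dot (a *: u) v = a * dot u v.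
Proof. by rewrite /dot mulr_sumr; apply: eq_bigr => i _; rewrite mxE mulrA. Qed.

Lemma dotZr n a (u v : 'rV['F_2]_n) : dot u (a *: v) = a * dot u v.
Proof. by rewrite dotC dotZl dotC. Qed.

(** Modulo 4, twice the size of the common support depends only on the parity of that size, which is
    the inner product. *)
Lemma wtD_mod4 n (u v : 'rV['F_2]_n) :
  (wt (u + v) = wt u + wt v + 2 * (dot u v != 0%R) %[mod 4])%N.
Proof.
rewrite -wtD_sum dot_sum natr_F2_eq0 negbK; set k := (\sum_i _)%N.
by have := odd_double_half k; case: (odd k) => /=; lia.
Qed.

Lemma F2_addKbb n (u v : 'rV['F_2]_n) : u + (u + v) = v.
Proof. by rewrite addrA F2_addbb add0r. Qed.

Lemma mem_translate n u (A : {set 'rV['F_2]_n}) v :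
  (v \in translate u A) = (u + v \in A).
Proof.
apply/imsetP/idP => [[w wA ->] | uvA]; first by rewrite F2_addKbb.
by exists (u + v); rewrite // F2_addKbb.
Qed.

Lemma dualP n (A : {set 'rV['F_2]_n}) u :
  reflect (forall v, v \in A -> dot u v = 0) (u \in dual A).
Proof.
by rewrite inE; apply: (iffP forall_inP) => H v /H; [move/eqP | move=> ->].
Qed.

(** * Minimum weights and the covering radius *)

Lemma min_wt_le n (A : {set 'rV['F_2]_n}) v : v \in A -> (min_wt A <= wt v)%N.
Proof.
move=> vA; rewrite /min_wt -minEnat -leEnat.
exact: (bigmin_le_cond n (fun v : 'rV['F_2]_n => wt v)).
Qed.

(** The bound [k <= n] handles the default value [n] of [min_wt]. *)
Lemma min_wt_ge n (A : {set 'rV['F_2]_n}) k :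
  (k <= n)%N -> (forall v, v \in A -> (k <= wt v)%N) -> (k <= min_wt A)%N.
Proof.
move=> kn kA; rewrite /min_wt; elim/big_ind: _ => // a b ka kb.
by rewrite leq_min ka.
Qed.

Lemma min_wt_attained n (A : {set 'rV['F_2]_n}) v0 :
  v0 \in A -> exists2 v, v \in A & wt v = min_wt A.
Proof.
move=> v0A; case: (arg_minnP (fun v : 'rV['F_2]_n => wt v) v0A) => v vA vmin.
exists v => //; apply/eqP; rewrite eqn_leq min_wt_le // andbT.
exact: min_wt_ge (wt_le v) vmin.
Qed.

Lemma covering_radius_attained n (C : {vspace 'rV['F_2]_n}) :
  exists2 u, wt u = covering_radius C &
    forall c, c \in C -> (covering_radius C <= wt (u + c))%N.
Proof.
pose f (u : 'rV['F_2]_n) := min_wt (translate u (codewords C)).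
have [u0 u0E] : {u0 | \max_u f u = f u0}.
  by apply: bigop.eq_bigmax; apply/card_gt0P; exists 0.
have u0C : u0 \in translate u0 (codewords C).
  by rewrite mem_translate F2_addbb inE mem0v.
have [u] := min_wt_attained u0C; rewrite mem_translate inE -/(f u0) -u0E => uC uE.
exists u; rewrite // /covering_radius u0E => c cC; apply: min_wt_le.
by rewrite mem_translate inE addrA rpredD.
Qed.

Lemma covering_radius_covers n (C : {vspace 'rV['F_2]_n}) u :
  exists2 c, c \in C & (wt (u + c) <= covering_radius C)%N.
Proof.
have : u \in translate u (codewords C).
  by rewrite mem_translate F2_addbb inE mem0v.
case/min_wt_attained => v; rewrite mem_translate inE => uvC wt_v.
exists (u + v); rewrite // F2_addKbb wt_v.
exact: (bigop.leq_bigmax (F := fun u => min_wt (translate u (codewords C)))).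
Qed.

(** * Self-dual codes *)

Section SelfDual.

Variables (n : nat) (C : {vspace 'rV['F_2]_n}).
Hypothesis sdC : self_dual C.

Lemma self_dualP u :
  reflect (forall v, v \in C -> dot u v = 0) (u \in C).
Proof.
have <- : (u \in codewords C) = (u \in C) by rewrite inE.
rewrite sdC; apply: (iffP (dualP _ _)) => uC v.
  by move=> vC; apply: uC; rewrite inE.
by rewrite inE; exact: uC.
Qed.

Lemma self_dual_dot u v : u \in C -> v \in C -> dot u v = 0.
Proof. by move/self_dualP; apply. Qed.

Lemma self_dual_even u : u \in C -> ~~ odd (wt u).
Proof. by move=> uC; rewrite -natr_F2_eq0 -dot_self self_dual_dot. Qed.

Lemma self_dual_ones : const_mx 1 \in C.
Proof.
by apply/self_dualP => v /self_dual_even; rewrite dot1 -natr_F2_eq0 => /eqP.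
Qed.

(** For a generator matrix [M], self-duality says that the row space of [M] is the kernel of [M^T];
    rank-nullity then gives the dimension. *)
Lemma dim_self_dual : (\dim C * 2 = n)%N.
Proof.
pose M : 'M['F_2]_(\dim C, n) := \matrix_i (vbasis C)`_i.
have mulM (w : 'rV_(\dim C)) : w *m M = \sum_i w 0 i *: (vbasis C)`_i.
  by rewrite mulmx_sum_row; apply: eq_bigr => i _; rewrite rowK.
have freeM : row_free M.
  apply: inj_row_free => w; rewrite mulM => w0; apply/rowP => i; rewrite mxE.
  have /freeP freeC := basis_free (vbasisP C).
  exact: (freeC (w 0)).
have memM v : (v \in C) = (v <= M)%MS.
  apply/idP/submxP => [vC | [w ->]].
    exists (\row_i coord (vbasis C) i v); rewrite mulM {1}(coord_vbasis vC).
    by apply: eq_bigr => i _; rewrite mxE.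
  rewrite mulM rpred_sum // => i _.
  by rewrite rpredZ ?vbasis_mem ?mem_nth ?size_tuple.
have mulMT v i : (v *m M^T) 0 i = dot v (vbasis C)`_i.
  by rewrite mxE; apply: eq_bigr => k _; rewrite !mxE.
have kerM : (M :=: kermx M^T)%MS.
  apply/eqmxP/rV_eqP => v; rewrite -memM.
  apply/self_dualP/sub_kermxP => [vC | vM].
    by apply/rowP => i; rewrite mulMT mxE vC // vbasis_mem ?mem_nth ?size_tuple.
  move=> c; rewrite memM => /submxP[w ->].
  have -> : dot v (w *m M) = ((v *m M^T) *m w^T) 0 0.
    rewrite -mulmxA -trmx_mul mxE /dot.
    by apply: eq_bigr => k _; rewrite !mxE.
  by rewrite vM mul0mx mxE.
have := mxrank_ker M^T; rewrite -kerM mxrank_tr (eqP freeM).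
have := rank_leq_col M; rewrite (eqP freeM); lia.
Qed.

End SelfDual.

(** Used to turn the set [glued] into a vector space: a dual is closed under addition, and the only
    scalars are 0 and 1. *)
Lemma self_dual_set_vspace n (A : {set 'rV['F_2]_n}) :
  A = dual A -> exists D : {vspace 'rV['F_2]_n}, codewords D = A.
Proof.
move=> sdA.
have A0 : 0 \in A by rewrite sdA; apply/dualP => v _; rewrite dotC dot0.
have AD u v : u \in A -> v \in A -> u + v \in A.
  rewrite sdA => /dualP uA /dualP vA; apply/dualP => w wA.
  by rewrite dotDl uA ?vA ?addr0 // -sdA.
exists <<enum A>>%VS; apply/setP => v; rewrite inE.
apply/idP/idP => [vA | vA]; last by rewrite memv_span // mem_enum.
rewrite (coord_span (X := in_tuple (enum A)) vA).
elim/big_ind: _ => // i _.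
have iA : (in_tuple (enum A))`_i \in A by rewrite -mem_enum mem_nth.
by case: (F2_cases (coord (in_tuple (enum A)) i v)) => ->;
  rewrite ?scale0r ?scale1r.
Qed.

(** * Delsarte's bound on the covering radius *)

Definition sgn2 (a : 'F_2) : int := (-1) ^+ (a != 0).

Lemma sgn2D a b : sgn2 (a + b) = sgn2 a * sgn2 b.
Proof.
by case: (F2_cases a) => ->; case: (F2_cases b) => ->;
  rewrite /sgn2 ?addr0 ?F2_add1.
Qed.

Lemma dot_delta n (i : 'I_n) (c : 'rV['F_2]_n) : dot (delta_mx 0 i) c = c 0 i.
Proof.
rewrite /dot (bigD1 i) //= mxE !eqxx mul1r big1 ?addr0 // => j ne_ji.
by rewrite mxE eqxx (negPf ne_ji) mul0r.
Qed.

Lemma double_wt_sgn2 n (c : 'rV['F_2]_n) :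
  2 * (wt c)%:R = n%:R - \sum_i sgn2 (c 0 i).
Proof.
rewrite wt_sum natr_sum mulr_sumr -[in n%:R](card_ord n) -sumr_const -sumrB.
by apply: eq_bigr => i _; case: (F2_cases (c 0 i)) => ->.
Qed.

(** Orthogonality of characters, [sgn2] being the nontrivial one of ['F_2]: translating the sum by a
    codeword [c0] not orthogonal to [u] changes its sign. *)
Lemma sgn2_sum_self_dual n (C : {vspace 'rV['F_2]_n}) u :
  self_dual C -> u \notin C -> \sum_(c in C) sgn2 (dot u c) = 0.
Proof.
move=> sdC uC; set S := \sum_(c in C) _.
have [c0 c0C uc0] : exists2 c0, c0 \in C & dot u c0 = 1.
  have: u \notin dual (codewords C) by rewrite -sdC inE.
  rewrite inE negb_forall_in => /existsP[c0 /andP[]]; rewrite inE => c0C.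
  by case: (F2_cases (dot u c0)) => uc0; rewrite uc0 // => _; exists c0.
suff: S = - S by move=> ?; lia.
rewrite {1}/S (reindex_inj (addrI c0)) /= -sumrN.
apply: eq_big => [c | c _]; first by rewrite rpredDl.
by rewrite dotDr sgn2D uc0 mulN1r.
Qed.

Lemma sgn2_weight_sum_eq0 n (C : {vspace 'rV['F_2]_n}) (W : seq nat) u :
  self_dual C -> (forall c, c \in C -> (size W < wt (u + c))%N) ->
  \sum_(c in C) sgn2 (dot u c) * \prod_(w <- W) (2 * (wt c)%:R - 2 * w%:R) = 0.
Proof.
move=> sdC; elim: W u => [|w W IH] u far_u.
  under eq_bigr do rewrite big_nil mulr1.
  apply: sgn2_sum_self_dual => //; apply/negP => uC.
  by have:= far_u _ uC; rewrite F2_addbb wt0.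
pose G v := \sum_(c in C) sgn2 (dot v c) *
              \prod_(w <- W) (2 * (wt c)%:R - 2 * w%:R).
transitivity ((n%:R - 2 * w%:R) * G u - \sum_i G (u + delta_mx 0 i)).
  rewrite /G exchange_big mulr_sumr -sumrB; apply: eq_bigr => c _ /=.
  under [X in _ - X]eq_bigr do rewrite dotDl dot_delta sgn2D.
  rewrite -mulr_suml -mulr_sumr big_cons double_wt_sgn2; ring.
rewrite [G u]IH => [|c /far_u]; last by move=> /= ?; lia.
rewrite big1 ?mulr0 ?subr0 // => i _; apply: IH => c /far_u /=.
(* Adding a unit vector brings [u] closer to [C] by at most one, and [W] is one shorter than
   [w :: W]. *)
have := wtD_le (delta_mx 0 i) (u + delta_mx 0 i + c).
have -> : delta_mx 0 i + (u + delta_mx 0 i + c) = u + c.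
  by rewrite -addrA addrCA F2_addKbb.
by rewrite wt_delta; lia.
Qed.

Lemma covering_radius_le_weights n (C : {vspace 'rV['F_2]_n}) (W : seq nat) :
  self_dual C -> (0 \notin W)%N ->
  (forall c, c \in C -> c != 0 -> wt c \in W) ->
  (covering_radius C <= size W)%N.
Proof.
move=> sdC W0 wtW; rewrite leqNgt; apply/negP => ltWR.
have [u _ farR] := covering_radius_attained C.
have far_u c : c \in C -> (size W < wt (u + c))%N.
  by move/farR; apply: leq_trans.
have := sgn2_weight_sum_eq0 sdC far_u.
rewrite (bigD1 0) ?mem0v //= dot0 mul1r.
rewrite [X in _ + X]big1 => [|c /andP[cC c0]]; last first.
  by rewrite (big_rem _ (wtW c cC c0)) /= subrr mul0r mulr0.
move/eqP; rewrite addr0 prodf_seq_eq0 => /hasP[w wW].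
by rewrite wt0 /= => w0; have : w = 0%N by [lia]; move=> w_0; rewrite -w_0 wW in W0.
Qed.

(** * Weights in extremal codes and the choice of x *)

Lemma extremal_wt_ge t (C : {vspace 'rV['F_2]_(8 * t)}) c :
  extremal C -> c \in C -> c != 0 -> (4 * (t %/ 3) + 4 <= wt c)%N.
Proof.
rewrite /extremal /self_dual_bound => exC cC c0.
have : (min_weight C <= wt c)%N by apply: min_wt_le; rewrite !inE c0.
(* A multiple of 8 is never 22 modulo 24, and [8 * t %/ 24] is [t %/ 3]. *)
by rewrite exC; case: ifP; lia.
Qed.

Lemma wt_onesD n (c : 'rV['F_2]_n) : (wt (const_mx 1 + c)%R + wt c = n)%N.
Proof.
rewrite !wt_sum -big_split -[RHS]card_ord -sum1_card; apply: eq_bigr => i _.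
by rewrite !mxE; case: (F2_cases (c 0 i)) => ->.
Qed.

Lemma extremal_covering_radius_le t (C : {vspace 'rV['F_2]_(8 * t)}) :
  self_dual C -> doubly_even C -> extremal C -> (0 < t)%N ->
  (covering_radius C <= 4 * (t %/ 3) + 4)%N.
Proof.
move=> sdC deC exC t_gt0; set m := (t %/ 3)%N.
(* The multiples of 4 from [4m + 4] to [8t - (4m + 4)], and [8t]: these are [2t - 2m] values, at
   most [4m + 4] because [t <= 3m + 2]. *)
pose W := (8 * t)%N :: [seq (4 * k)%N | k <- iota m.+1 (2 * t - 2 * m - 1)].
apply: (@leq_trans (size W)); last by rewrite /= size_map size_iota /m; lia.
apply: covering_radius_le_weights => // [|c cC c0].
  rewrite inE negb_or; apply/andP; split; first lia.
  by apply/mapP => -[k]; rewrite mem_iota; lia.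
rewrite inE; have := wt_onesD c.
have [-> | jc0] := eqVneq (const_mx 1 + c) 0.
  by rewrite wt0 add0n => ->; rewrite eqxx.
(* The complement of [c] is also a nonzero codeword, which bounds [wt c] above by
   [8t - (4m + 4)]. *)
have jC : const_mx 1 + c \in C by rewrite rpredD // self_dual_ones.
have := extremal_wt_ge exC jC jc0; have := extremal_wt_ge exC cC c0.
rewrite -/m => c_ge jc_ge wt_jc; have := deC c cC; rewrite mod0n => c4.
apply/orP; right; apply/mapP; exists (wt c %/ 4)%N; last by lia.
have := leq_add jc_ge (leqnn (wt c)); rewrite wt_jc mem_iota; lia.
Qed.

(* Deleting a coordinate from a deep hole of even weight keeps it a minimum
   weight vector of its coset, and makes the weight odd. *)
Lemma odd_coset_leader n (C : {vspace 'rV['F_2]_n}) :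
  (0 < covering_radius C)%N ->
  exists2 x, wt x = (2 * ((covering_radius C + 1) %/ 2) - 1)%N &
    forall c, c \in C -> (wt x <= wt (x + c))%N.
Proof.
move=> R_gt0; have [u uR farR] := covering_radius_attained C.
have [R_odd | R_even] := boolP (odd (covering_radius C)).
  by exists u; [lia | move=> c /farR; rewrite uR].
have [i ui] : exists i, u 0 i = 1.
  have : u != 0 by apply: contraTneq R_gt0 => u0; rewrite -uR u0 wt0.
  case/rV0Pn => i ui; exists i; move: ui.
  by case: (F2_cases (u 0 i)) => ->; rewrite ?eqxx.
have wt_x : (wt (u + delta_mx 0 i)).+1 = covering_radius C.
  rewrite -uR !wt_sum (bigD1 i) //= [RHS](bigD1 i) //= !mxE ui !eqxx /= add0n.
  congr _.+1; apply: eq_bigr => j ne_ji.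
  by rewrite !mxE (negPf ne_ji) andbF addr0.
exists (u + delta_mx 0 i) => [|c /farR]; first by lia.
have := wtD_le (delta_mx 0 i) (u + delta_mx 0 i + c).
have -> : delta_mx 0 i + (u + delta_mx 0 i + c) = u + c.
  by rewrite -addrA addrCA F2_addKbb.
by rewrite wt_delta; lia.
Qed.

(** * Words with two extra coordinates *)

Definition glue n (a b : 'F_2) (y : 'rV['F_2]_n) : 'rV['F_2]_(2 + n) :=
  row_mx (\row_(i < 2) [:: a; b]`_i) y.

Lemma glue_surj n (v : 'rV['F_2]_(2 + n)) : exists a b y, v = glue a b y.
Proof.
exists (v 0 (lshift n 0)), (v 0 (lshift n 1)), (rsubmx v).
rewrite /glue -[LHS]hsubmxK; congr row_mx; apply/rowP => i; rewrite !mxE.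
by case: i => [[|[|i]] lti] //=; congr (v _ (lshift _ _)); apply: val_inj.
Qed.

Lemma glue_dot n a b (y : 'rV['F_2]_n) a' b' y' :
  dot (glue a b y) (glue a' b' y') = a * a' + b * b' + dot y y'.
Proof.
rewrite /dot big_split_ord /= !big_ord_recl big_ord0 addr0 !row_mxEl !mxE /=.
by congr (_ + _); apply: eq_bigr => i _; rewrite !row_mxEr.
Qed.

Lemma glue_wt n a b (y : 'rV['F_2]_n) :
  wt (glue a b y) = ((a != 0%R) + (b != 0%R) + wt y)%N.
Proof.
rewrite !wt_sum big_split_ord /= !big_ord_recl big_ord0 addn0 !row_mxEl !mxE /=.
by congr (_ + _)%N; apply: eq_bigr => i _; rewrite !row_mxEr.
Qed.

Lemma glue0 n : 0 = glue 0 0 0 :> 'rV['F_2]_(2 + n).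
Proof.
apply/esym/wt_eq0; by rewrite glue_wt wt0 eqxx.
Qed.

Lemma mem_prefix2 n a b (A : {set 'rV['F_2]_n}) a' b' y :
  (glue a' b' y \in prefix2 a b A) = [&& a' == a, b' == b & y \in A].
Proof.
apply/imsetP/and3P => [[c cA /eq_row_mx[/rowP ab ->]] | [/eqP-> /eqP-> yA]].
  by have := ab 0; have := ab 1; rewrite !mxE /= => -> ->; rewrite !eqxx.
by exists y.
Qed.

(** * The code C(x): self-duality, weights and shadow *)

Section Construction.

Variables (n : nat) (C : {vspace 'rV['F_2]_n}) (x : 'rV['F_2]_n).
Hypotheses (sdC : self_dual C) (oddx : odd (wt x)).

Let j : 'rV['F_2]_n := const_mx 1.

Let jC : j \in C. Proof. exact: self_dual_ones. Qed.

Let jx : dot j x = 1. Proof. by rewrite dot1 natr_F2 oddx. Qed.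

Let xx : dot x x = 1. Proof. by rewrite dot_self natr_F2 oddx. Qed.

Lemma mem_orth_subcode c :
  (c \in orth_subcode C x) = (c \in C) && (dot c x == 0).
Proof. by rewrite inE. Qed.

(** Inside C, the cosets of C^0 are the fibres of the linear form [dot _ x]. *)
Lemma mem_translate_orth_subcode u c :
  u \in C ->
  (c \in translate u (orth_subcode C x)) = (c \in C) && (dot c x == dot u x).
Proof.
move=> uC; rewrite mem_translate mem_orth_subcode rpredDl // dotDl.
by congr (_ && _); case: (F2_cases (dot u x)) => ->; case: (F2_cases (dot c x)) => ->.
Qed.

(* The two labellings of the cosets in x + C correspond to e = 0 and e = 1. *)
Lemma coset_labellingE (C1 C2 C3 : {set 'rV['F_2]_n}) :
  coset_labelling C x C1 C2 C3 ->
  exists e : 'F_2,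
    [/\ C1 =i [pred v | (x + v \in C) && (dot (x + v) x == e)],
        C2 =i [pred v | (v \in C) && (dot v x == 1)],
        C3 =i [pred v | (x + v \in C) && (dot (x + v) x == e + 1)]
      & dual (orth_subcode C x) =i [pred v | (v \in C) || (x + v \in C)]].
Proof.
case=> -[[u1 C1E] [u2 C2E] [u3 C3E]] dualC0 C02 C13.
have O0 : 0 \in orth_subcode C x.
  by rewrite mem_orth_subcode mem0v dotC dot0 eqxx.
have inxC v : (x + v \in C) = (v \in C1) || (v \in C3).
  by rewrite -in_setU -C13 mem_translate inE.
have memC v : (v \in C) = (v \in orth_subcode C x) || (v \in C2).
  by rewrite -in_setU -C02 inE.
have mem_shift u v : x + u \in C ->
  (v \in translate u (orth_subcode C x)) =
  (x + v \in C) && (dot (x + v) x == dot (x + u) x).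
  move=> xuC; rewrite -(mem_translate_orth_subcode _ xuC) !mem_translate.
  by rewrite -[x + u + _]addrA (addrCA u) F2_addKbb.
have u1C : x + u1 \in C by rewrite inxC C1E mem_translate F2_addbb O0.
have u3C : x + u3 \in C by rewrite inxC C3E mem_translate F2_addbb O0 orbT.
have u2C : u2 \in C by rewrite memC C2E mem_translate F2_addbb O0 orbT.
(* The all-one word [j] is in C but not in C^0, hence in C^2. *)
have u2x : dot u2 x = 1.
  have := memC j; rewrite jC mem_orth_subcode jx C2E mem_translate_orth_subcode //.
  by rewrite jC jx; case: (F2_cases (dot u2 x)) => ->.
(* [u1 + j] is in x + C, but adding [j] changes the product with [x], so it leaves C^1 and must lie
   in C^3. *)
have u3x : dot (x + u3) x = dot (x + u1) x + 1.
  have := inxC (u1 + j); rewrite addrA rpredD // C1E C3E !mem_shift // addrA rpredD //=.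
  rewrite (dotDl _ j) jx; case: (F2_cases (dot (x + u1) x)) => ->;
    by case: (F2_cases (dot (x + u3) x)) => ->; rewrite ?add0r ?F2_add1.
exists (dot (x + u1) x); split=> v; rewrite [RHS]inE.
- by rewrite C1E mem_shift.
- by rewrite C2E mem_translate_orth_subcode // u2x.
- by rewrite C3E mem_shift // u3x.
- by rewrite dualC0 !in_setU memC inxC -!orbA; congr orb; rewrite orbCA.
Qed.

Variables (C1 C2 C3 : {set 'rV['F_2]_n}) (e : 'F_2).
Hypothesis C1E : C1 =i [pred v | (x + v \in C) && (dot (x + v) x == e)].
Hypothesis C2E : C2 =i [pred v | (v \in C) && (dot v x == 1)].
Hypothesis C3E : C3 =i [pred v | (x + v \in C) && (dot (x + v) x == e + 1)].
Hypothesis dualC0 :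
  dual (orth_subcode C x) =i [pred v | (v \in C) || (x + v \in C)].

Let G := glued (orth_subcode C x) C1 C2 C3.

(** One formula for all four pieces: [a + b] selects C or x + C, and the product with [x] selects
    the coset of C^0 within it. *)
Lemma mem_glued a b y :
  (glue a b y \in G) =
  ((a + b) *: x + y \in C) && (dot ((a + b) *: x + y) x == b + (a + b) * e).
Proof.
rewrite !in_setU !mem_prefix2 mem_orth_subcode C1E C2E C3E !inE.
case: (F2_cases a) => ->; case: (F2_cases b) => ->;
  rewrite ?addr0 ?add0r ?F2_add1 ?scale0r ?scale1r ?mul0r ?mul1r ?add0r ?addr0 /=
          ?orbF //.
by rewrite (addrC e).
Qed.

Lemma glued_self_dual : G = dual G.
Proof.
apply/setP => u; have [a [b [y ->]]] := glue_surj u.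
apply/idP/dualP => [|uG].
  rewrite mem_glued => /andP[zC /eqP zx] v.
  have [a' [b' [y' ->]]] := glue_surj v.
  rewrite mem_glued => /andP[z'C /eqP z'x].
  rewrite glue_dot.
  have := self_dual_dot sdC zC z'C; move: zx z'x.
  rewrite !(dotDl, dotDr, dotZl, dotZr) xx (dotC x y').
  move: (dot y x) (dot y' x) (dot y y') => p q r /eqP zx /eqP z'x /eqP zz'.
  apply/eqP; move: zx z'x zz'.
  by case: (F2_cases a) => ->; case: (F2_cases b) => ->;
     case: (F2_cases a') => ->; case: (F2_cases b') => ->;
     case: (F2_cases e) => ->; case: (F2_cases p) => ->;
     case: (F2_cases q) => ->; case: (F2_cases r) => ->.
(* Orthogonality to (0,0,C^0) puts [y] in C or x + C; the words (1,1,j) and (1,0,x + ej) of the code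
   then yield the two conditions of [mem_glued]. *)
have y_dual : y \in dual (orth_subcode C x).
  apply/dualP => c cC0.
  have : dot (glue a b y) (glue 0 0 c) = 0.
    by apply: uG; rewrite !in_setU mem_prefix2 !eqxx cC0.
  by rewrite glue_dot !mulr0 !add0r.
have [s zC] : exists s, s *: x + y \in C.
  move: y_dual; rewrite dualC0 => /orP[yC | xyC].
    by exists 0; rewrite scale0r add0r.
  by exists 1; rewrite scale1r.
have jG : glue 1 1 j \in G.
  by rewrite mem_glued F2_add1 scale0r add0r jC jx mul0r addr0 eqxx.
have xjG : glue 1 0 (x + e *: j) \in G.
  rewrite mem_glued addr0 scale1r F2_addKbb dotZl jx add0r mulr1 mul1r eqxx andbT.
  by rewrite rpredZ.
have := uG _ jG; have := uG _ xjG; have := self_dual_dot sdC zC jC.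
rewrite mem_glued !glue_dot !(dotDl, dotDr, dotZl, dotZr) xx (dotC x j) jx => zj ux uj.
have abs : a + b = s.
  move: (dot y j) zj uj => p /eqP zj /eqP uj; apply/eqP; move: zj uj.
  by case: (F2_cases a) => ->; case: (F2_cases b) => ->; case: (F2_cases s) => ->;
     case: (F2_cases p) => ->.
rewrite abs zC /=; move: (dot y j) (dot y x) zj ux => p q.
move: abs => /eqP abs /eqP zj /eqP ux; move: abs zj ux.
by case: (F2_cases a) => ->; case: (F2_cases b) => ->; case: (F2_cases s) => ->;
   case: (F2_cases e) => ->; case: (F2_cases p) => ->; case: (F2_cases q) => ->.
Qed.

(** If [a + b = 0], then [y] is in C, and [y = 0] forces [a = b = 0]. If [a + b = 1], then [y] is in
    x + C and the prefix adds one to its weight. *)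
Lemma glued_wt_ge v :
  (forall c, c \in C -> (wt x <= wt (x + c))%N) ->
  (forall c, c \in C -> c != 0 -> (wt x < wt c)%N) ->
  v \in G -> v != 0 -> (wt x < wt v)%N.
Proof.
move=> leader_x ltC; have [a [b [y ->]]] := glue_surj v.
rewrite mem_glued glue_wt => /andP[zC /eqP zx].
have [ab | ab] := F2_cases (a + b); rewrite ab ?scale0r ?add0r ?scale1r in zC zx *.
  have [y0 | /(ltC _ zC) lt_y _] := eqVneq y 0; last by lia.
  move: zx; rewrite y0 dotC dot0 mul0r addr0 => b0.
  by move: ab; rewrite -b0 addr0 => ->; rewrite -glue0 => /eqP.
have := leader_x _ zC; rewrite F2_addKbb => le_y _.
suff: ((a != 0%R) + (b != 0%R) = 1)%N by lia.
by move/eqP: ab; case: (F2_cases a) => ->; case: (F2_cases b) => ->.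
Qed.

Lemma glued_wt_attained : exists2 v, v \in G & wt v = (wt x).+1.
Proof.
(* [x = x + 0] lies in C^1 when [e = 0] and in C^3 when [e = 1]. *)
exists (glue (e + 1) e x); last first.
  by rewrite glue_wt; case: (F2_cases e) => ->; rewrite ?add0r ?F2_add1 ?oner_eq0 ?eqxx.
rewrite mem_glued; have -> : e + 1 + e = 1.
  by apply/eqP; case: (F2_cases e) => ->.
rewrite scale1r F2_addbb mem0v mul1r dotC dot0 /=.
by case: (F2_cases e) => ->.
Qed.

Lemma glued_singly_even : (n %% 4 = 0)%N -> exists2 v, v \in G & (wt v %% 4 = 2)%N.
Proof.
(* The all-one word, of weight [n + 2]. *)
move=> n4; exists (glue 1 1 j).
  by rewrite mem_glued F2_add1 scale0r add0r jC jx mul0r addr0 eqxx.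
have := wt_onesD (0 : 'rV['F_2]_n); rewrite addr0 wt0 addn0 glue_wt -/j => ->.
rewrite oner_eq0 /=; lia.
Qed.

(* Modulo 4 the weight of x + z, z in C, depends only on dot z x, so exactly
   one of (1,0,C1) and (0,1,C3) consists of words of weight 0 mod 4; the weight
   one vector of the shadow is (0,1,0) in the first case, (1,0,0) in the second. *)
Lemma glued_shadow_wt1 : doubly_even C ->
  exists2 p, p \in dual [set v in G | (wt v %% 4 == 0)%N] :\: G & wt p = 1%N.
Proof.
(* A word with [a + b = 1] has weight [1 + wt x + 2(b + e)] modulo 4; [f] is the value of [b + e]
   that makes this 0. *)
move=> deC; pose f : 'F_2 := (wt x %% 4 == 1)%N%:R.
exists (glue (f + e) (f + e + 1) 0); last first.
  rewrite glue_wt wt0.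
  by case: (F2_cases (f + e)) => ->; rewrite ?add0r ?F2_add1 ?oner_eq0 ?eqxx.
rewrite in_setD; apply/andP; split.
  (* The weight one vector is not orthogonal to (1,1,j). *)
  apply/negP; rewrite glued_self_dual => /dualP.
  move=> /(_ (glue 1 1 j)); rewrite glue_dot dotC dot0.
  rewrite mem_glued F2_add1 scale0r add0r jC jx mul0r addr0 eqxx => /(_ isT)/eqP.
  by case: (F2_cases (f + e)) => ->.
apply/dualP => v; have [a [b [y ->]]] := glue_surj v.
rewrite inE mem_glued glue_wt glue_dot [dot 0 _]dotC dot0 addr0.
move=> /andP[/andP[zC /eqP zx] /eqP w4]; apply/eqP.
have [ab | ab] := F2_cases (a + b).
  rewrite ab scale0r add0r mul0r addr0 in zC zx.
  have := deC y zC; rewrite mod0n => y4.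
  move: ab w4 => /eqP; case: (F2_cases a) => ->; case: (F2_cases b) => -> //.
    by rewrite !mulr0.
  by rewrite oner_eq0 /=; lia.
rewrite ab scale1r mul1r in zC zx.
have ab1 : ((a != 0%R) + (b != 0%R) = 1)%N.
  by move/eqP: ab; case: (F2_cases a) => ->; case: (F2_cases b) => ->.
have [z yE] : exists z, y = x + z by exists (x + y); rewrite F2_addKbb.
rewrite yE F2_addKbb in zC zx.
have := wtD_mod4 x z; rewrite -yE (dotC x) zx.
have := deC _ zC; rewrite mod0n ab1 in w4 * => z4 y4.
have fE : f = b + e.
  have [be | be] := F2_cases (b + e); rewrite be ?eqxx ?oner_eq0 /= in y4 *;
    rewrite /f; case: eqP => // x4; exfalso; lia.
have bE : b = f + e.
  by apply/eqP; rewrite fE; case: (F2_cases b) => ->; case: (F2_cases e) => ->.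
move/eqP: ab; rewrite -bE.
by case: (F2_cases a) => ->; case: (F2_cases b) => ->.
Qed.

End Construction.

(** * Parameters and shadow of C(x) for an odd-weight coset leader x *)

Theorem theorem5 (t R : nat) (C : {vspace 'rV['F_2]_(8 * t)}) :
  self_dual C -> doubly_even C -> extremal C -> covering_radius C = R ->
  exists x : 'rV['F_2]_(8 * t),
    wt x = (2 * ((R + 1) %/ 2) - 1)%N /\
    forall C1 C2 C3 : {set 'rV['F_2]_(8 * t)},
      coset_labelling C x C1 C2 C3 ->
      exists D : {vspace 'rV['F_2]_(2 + 8 * t)},
        [/\ codewords D = glued (orth_subcode C x) C1 C2 C3,
            self_dual D,
            singly_even D,
            \dim D = (4 * t + 1)%N /\
            min_weight D = minn (4 * (t %/ 3) + 4) (2 * ((R + 1) %/ 2))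
          & minimal_shadow D].
Proof.
move=> sdC deC exC <- {R}.
have t_gt0 : (0 < t)%N.
  case: posnP => // t0; move: exC; rewrite /extremal /self_dual_bound => exC.
  (* [min_wt] never exceeds the length, so length 0 cannot reach the bound 4. *)
  have : (min_weight C <= 8 * t)%N.
    by rewrite /min_weight /min_wt -minEnat -leEnat; apply: bigmin_le_id.
  by rewrite exC; case: ifP; lia.
(* With covering radius 0 a unit vector would be a codeword of odd weight. *)
have R_gt0 : (0 < covering_radius C)%N.
  have n_gt0 : (0 < 8 * t)%N by lia.
  have [c cC] := covering_radius_covers C (delta_mx 0 (Ordinal n_gt0)).
  rewrite lt0n; apply: contraTneq => ->; rewrite leqn0; apply/eqP => /wt_eq0 c0.
  have := self_dual_even sdC cC.
  by rewrite -(F2_addKbb (delta_mx 0 (Ordinal n_gt0)) c) c0 addr0 wt_delta.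
have R_le := extremal_covering_radius_le sdC deC exC t_gt0.
have [x wt_x leader_x] := odd_coset_leader R_gt0.
exists x; split=> // C1 C2 C3 lab.
have oddx : odd (wt x) by lia.
have [e [C1E C2E C3E dualC0]] := coset_labellingE sdC oddx lab.
have sdG := glued_self_dual sdC oddx C1E C2E C3E dualC0.
have [D DE] := self_dual_set_vspace sdG.
have memD v : (v \in D) = (v \in glued (orth_subcode C x) C1 C2 C3).
  by rewrite -DE inE.
have sdD : self_dual D by rewrite /self_dual DE.
exists D; split=> //.
- have [|v vG v2] := glued_singly_even sdC oddx C1E C2E C3E; first by lia.
  by exists v; rewrite ?memD.
- split; first by have := dim_self_dual sdD; lia.
  (* [4 * (t %/ 3) + 4] is even and at least R, hence at least R rounded up to an even number. *)
  have -> : (minn (4 * (t %/ 3) + 4) (2 * ((covering_radius C + 1) %/ 2)) = (wt x).+1)%N.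
    by lia.
  have ltC c : c \in C -> c != 0 -> (wt x < wt c)%N.
    by move=> cC /(extremal_wt_ge exC cC); lia.
  have [v vG wt_v] := glued_wt_attained C1E C2E C3E.
  apply/eqP; rewrite eqn_leq -{1}wt_v; apply/andP; split.
    apply: min_wt_le; rewrite !inE memD vG andbT.
    by apply/eqP => v0; rewrite v0 wt0 in wt_v.
  apply: min_wt_ge => [|u]; first by rewrite -wt_v wt_le.
  rewrite !inE memD => /andP[u0 uG].
  exact: (glued_wt_ge sdC oddx C1E C2E C3E leader_x ltC uG u0).
- have [p pS wt_p] := glued_shadow_wt1 sdC oddx C1E C2E C3E dualC0 deC.
  rewrite /minimal_shadow /minimal_shadow_weight.
  have -> : ((2 + 8 * t) %% 8 = 2)%N by lia.
  have shE : shadow D = dual [set v in glued (orth_subcode C x) C1 C2 C3 |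
       (wt v %% 4 == 0)%N] :\: glued (orth_subcode C x) C1 C2 C3.
    rewrite /shadow DE; congr (dual _ :\: _).
    by apply/setP => v; rewrite !inE memD !inE.
  apply/eqP; rewrite eqn_leq; apply/andP; split.
    by rewrite -shE in pS; have := min_wt_le pS; rewrite wt_p.
  (* The zero vector is in [D], hence not in the shadow. *)
  apply: min_wt_ge => // v; rewrite inE => /andP[vD _]; rewrite lt0n.
  by apply: contraNneq vD => /wt_eq0->; rewrite inE mem0v.
Qed.
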